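(* Let $\alpha$ be a partial action of a group $G$ on a unital algebra $\mathcal{A}$ and suppose that $(\beta,\mathcal{B})$ is an enveloping action for $(\alpha,\mathcal{A})$ such that $\mathcal{B}$ is also unital. Then the skew group rings $\mathcal{A}\rtimes_\alpha G$ and $\mathcal{B}\rtimes_\beta G$ are Morita equivalent.
   Context: Let $K$ be a field. An algebra means an associative $K$-algebra, not necessarily unital; ideals are two-sided. A partial action $\alpha$ of a group $G$ (with identity $1$) on an algebra $\mathcal{A}$ is a collection of ideals $\mathcal{D}_g$ of $\mathcal{A}$ $(g\in G)$ and algebra isomorphisms $\alpha_g:\mathcal{D}_{g^{-1}}\to\mathcal{D}_g$ such that: (i) $\mathcal{D}_1=\mathcal{A}$ and $\alpha_1$ is the identity map of $\mathcal{A}$; (ii) $\mathcal{D}_{(gh)^{-1}}\supseteq \alpha_h^{-1}(\mathcal{D}_h\cap\mathcal{D}_{g^{-1}})$ for all $g,h\in G$; (iii) $\alpha_g\circ\alpha_h(x)=\alpha_{gh}(x)$ for each $x\in\alpha_h^{-1}(\mathcal{D}_h\cap\mathcal{D}_{g^{-1}})$. A (global) action of $G$ on $\mathcal{B}$ by automorphisms is the special case in which every $\mathcal{D}_g$ is $\mathcal{B}$. The skew group ring $\mathcal{A}\rtimes_\alpha G$ is the set of all finite formal sums $\sum_{g\in G}a_g\delta_g$ with $a_g\in\mathcal{D}_g$, where the $\delta_g$ are symbols, with the obvious addition and with (bilinear) multiplication determined by $(a_g\delta_g)\cdot(b_h\delta_h)=\alpha_g(\alpha_{g^{-1}}(a_g)b_h)\delta_{gh}$.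 For the global action $\beta$ this reads $(a\delta_g)(b\delta_h)=a\beta_g(b)\delta_{gh}$. Enveloping action: an action $\beta$ of $G$ on an algebra $\mathcal{B}$ by automorphisms $\beta_g$ is an enveloping action for the partial action $\alpha$ of $G$ on $\mathcal{A}$ if there is an algebra isomorphism $\varphi$ of $\mathcal{A}$ onto an ideal of $\mathcal{B}$ such that for all $g\in G$: $\varphi(\mathcal{D}_g)=\varphi(\mathcal{A})\cap\beta_g(\varphi(\mathcal{A}))$; $\varphi\circ\alpha_g(x)=\beta_g\circ\varphi(x)$ for each $x\in\mathcal{D}_{g^{-1}}$; and $\mathcal{B}$ is generated as an algebra by $\bigcup_{g\in G}\beta_g(\varphi(\mathcal{A}))$. (When such $\beta$ exists, $\mathcal{A}\rtimes_\alpha G$ embeds in $\mathcal{B}\rtimes_\beta G$ and so is associative.) Morita equivalence: rings $R,R'$ are Morita equivalent if there is a Morita context $(R,R',M,M',\tau,\tau')$ with $\tau,\tau'$ surjective (so the categories of $R$-modules and of $R'$-modules are equivalent). Here $M$ is an $R$-$R'$-bimodule, $M'$ an $R'$-$R$-bimodule, $\tau:M\otimes_{R'}M'\to R$ and $\tau':M'\otimes_R M\to R'$ are bimodule maps with $\tau(x\otimes x')y=x\tau'(x'\otimes y)$ and $\tau'(x'\otimes x)y'=x'\tau(x\otimes y')$ for all $x,y\in M$, $x',y'\in M'$. *)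

(* Defs.v *)
From HB Require Import structures.
From mathcomp Require Import all_boot all_algebra generic_quotient.
From mathcomp Require Import ring_quotient.
From mathcomp Require Import finmap monalg.
From mathcomp Require Import boolp classical_sets functions.

Set Implicit Arguments.
Unset Strict Implicit.
Unset Printing Implicit Defensive.

Import GRing.Theory.

Local Open Scope classical_set_scope.
Local Open Scope ring_scope.

(* Rings and algebras are not assumed to be unital. The class naRingType does
   not even require associativity, because the skew group ring of a partial
   action is not associative in general; associativity is part of
   nuAlgType and of morita_equivalent below. *)
HB.mixin Record Zmodule_isNaRing V of GRing.Zmodule V := {
  nmul : V -> V -> V;
  nmulDl : left_distributive nmul +%R;
  nmulDr : right_distributive nmul +%R
}.

#[short(type="naRingType")]
HB.structure Definition NaRing := {V of Zmodule_isNaRing V & GRing.Zmodule V}.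

Notation "x ** y" := (nmul x y) (at level 40, left associativity) : ring_scope.

HB.mixin Record NaRing_isNuAlgebra (K : fieldType) V
    of NaRing V & GRing.Lmodule K V := {
  nmulA : associative (@nmul V);
  nscaleAl : forall (a : K) (x y : V), a *: (x ** y) = (a *: x) ** y;
  nscaleAr : forall (a : K) (x y : V), a *: (x ** y) = x ** (a *: y)
}.

#[short(type="nuAlgType")]
HB.structure Definition NuAlgebra (K : fieldType) :=
  {V of NaRing_isNuAlgebra K V & NaRing V & GRing.Lmodule K V}.

Section NaRingTheory.
Variable R : naRingType.
Implicit Types x y : R.

Definition is_identity (e : R) : Prop := forall x, e ** x = x /\ x ** e = x.

Definition unital : Prop := exists e, is_identity e.

Lemma nmul0r x : 0 ** x = 0.
Proof. by apply: (addrI (0 ** x)); rewrite -nmulDl !addr0. Qed.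

Lemma nmulr0 x : x ** 0 = 0.
Proof. by apply: (addrI (x ** 0)); rewrite -nmulDr !addr0. Qed.

End NaRingTheory.

Section Subobjects.
Variables (K : fieldType) (A : nuAlgType K).
Implicit Types I C : set A.

Definition subspace I : Prop :=
  [/\ I 0, forall x y, I x -> I y -> I (x + y)
    & forall (a : K) x, I x -> I (a *: x)].

Definition ideal I : Prop :=
  subspace I /\ forall a x, I x -> I (a ** x) /\ I (x ** a).

Definition subalgebra C : Prop :=
  subspace C /\ forall x y, C x -> C y -> C (x ** y).

End Subobjects.

(* The isomorphism alpha_g : D_{g^-1} -> D_g is represented by a total function
   pa_map g, whose values outside D_{g^-1} are irrelevant (all the constructions
   below only evaluate pa_map g on D_{g^-1}). *)
Section PartialActions.
Variables (K : fieldType) (G : groupType).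

(* alpha_h^-1 (D_h `&` D_{g^-1}) *)
Definition comp_dom (A : Type) (D : G -> set A) (alpha : G -> A -> A)
    (g h : G) : set A :=
  D h^-1%g `&` alpha h @^-1` (D h `&` D g^-1%g).

Record partial_action (A : nuAlgType K) := PartialAction {
  pa_dom : G -> set A;
  pa_map : G -> A -> A;
  pa_ideal : forall g, ideal (pa_dom g);
  pa_bij : forall g, set_bij (pa_dom g^-1%g) (pa_dom g) (pa_map g);
  pa_mapD : forall g x y, pa_dom g^-1%g x -> pa_dom g^-1%g y ->
    pa_map g (x + y) = pa_map g x + pa_map g y;
  pa_mapZ : forall g (a : K) x, pa_dom g^-1%g x ->
    pa_map g (a *: x) = a *: pa_map g x;
  pa_mapM : forall g x y, pa_dom g^-1%g x -> pa_dom g^-1%g y ->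
    pa_map g (x ** y) = pa_map g x ** pa_map g y;
  pa_dom1 : pa_dom 1%g = setT;
  pa_map1 : forall x, pa_map 1%g x = x;
  pa_domM : forall g h,
    comp_dom pa_dom pa_map g h `<=` pa_dom (g * h)^-1%g;
  pa_comp : forall g h x, comp_dom pa_dom pa_map g h x ->
    pa_map g (pa_map h x) = pa_map (g * h)%g x
}.

Definition global (B : nuAlgType K) (beta : partial_action B) : Prop :=
  forall g, pa_dom beta g = setT.

Definition enveloping (A B : nuAlgType K)
    (alpha : partial_action A) (beta : partial_action B) : Prop :=
  global beta /\
  exists phi : {linear A -> B},
    [/\ injective phi,
        forall x y, phi (x ** y) = phi x ** phi y
      & ideal (range phi)] /\
    [/\ forall g, phi @` pa_dom alpha g
                  = range phi `&` pa_map beta g @` range phi,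
        forall g x, pa_dom alpha g^-1%g x ->
          phi (pa_map alpha g x) = pa_map beta g (phi x)
      & smallest (@subalgebra K B) (\bigcup_g pa_map beta g @` range phi)
        = setT].

End PartialActions.

Section PartialActionTheory.
Variables (K : fieldType) (G : groupType) (A : nuAlgType K).
Variable alpha : partial_action G A.
Local Notation D := (pa_dom alpha).
Local Notation al := (pa_map alpha).

Lemma pa_dom0 g : D g 0.
Proof. by have [[]] := pa_ideal alpha g. Qed.

Lemma pa_domD g x y : D g x -> D g y -> D g (x + y).
Proof. by have [[_ h _] _] := pa_ideal alpha g; apply: h. Qed.

Lemma pa_domZ g (a : K) x : D g x -> D g (a *: x).
Proof. by have [[_ _ h] _] := pa_ideal alpha g; apply: h. Qed.

Lemma pa_domMl g a x : D g x -> D g (a ** x).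
Proof. by have [_ h] := pa_ideal alpha g; move=> /(h a) []. Qed.

Lemma pa_domMr g a x : D g x -> D g (x ** a).
Proof. by have [_ h] := pa_ideal alpha g; move=> /(h a) []. Qed.

Lemma pa_mapP g x : D g^-1%g x -> D g (al g x).
Proof. by have [h _ _] := pa_bij alpha g; apply: h. Qed.

Lemma pa_mapVP g x : D g x -> D g^-1%g (al g^-1%g x).
Proof. by move=> Dx; apply: pa_mapP; rewrite invgK. Qed.

Lemma pa_mapK g x : D g^-1%g x -> al g^-1%g (al g x) = x.
Proof.
move=> Dx; rewrite pa_comp ?mulVg ?pa_map1 //; split=> //=.
by rewrite invgK; split; apply: pa_mapP.
Qed.

Lemma pa_map0 g : al g 0 = 0.
Proof.
by have := pa_mapZ (0 : K) (pa_dom0 g^-1%g); rewrite !scale0r.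
Qed.

Lemma pa_map_dom g h x : D g^-1%g x -> D h x -> D (g * h)%g (al g x).
Proof.
move=> Dx Dhx; have := @pa_domM _ _ _ alpha h^-1%g g^-1%g (al g x).
rewrite invgM !invgK; apply; split; first by rewrite invgK; apply: pa_mapP.
by rewrite /= pa_mapK // invgK.
Qed.

End PartialActionTheory.

Section SkewGroupRing.
Variables (K : fieldType) (G : groupType) (A : nuAlgType K).
Variable alpha : partial_action G A.
Local Notation D := (pa_dom alpha).
Local Notation al := (pa_map alpha).
Implicit Types x y z : {malg A[G]}.

(* << a *g g >> : {malg A[G]} is the formal monomial a delta_g. *)
Definition skew_pred : {pred {malg A[G]}} :=
  fun x => `[< forall g, D g x@_g >].

Lemma skew_predP x : reflect (forall g, D g x@_g) (x \in skew_pred).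
Proof. exact: asboolP. Qed.

Fact skew_zmod_closed : zmod_closed skew_pred.
Proof.
split=> [|x y /skew_predP Dx /skew_predP Dy]; apply/skew_predP=> g.
  by rewrite mcoeff0; apply: pa_dom0.
rewrite mcoeffB; apply: pa_domD (Dx g) _.
by rewrite -scaleN1r; apply/pa_domZ/Dy.
Qed.
HB.instance Definition _ :=
  GRing.isZmodClosed.Build {malg A[G]} skew_pred skew_zmod_closed.

Record skew_group_ring :=
  SkewGroupRing { skew_val :> {malg A[G]}; _ : skew_val \in skew_pred }.

HB.instance Definition _ := [isSub for skew_val].
HB.instance Definition _ := [Choice of skew_group_ring by <:].
HB.instance Definition _ := [SubChoice_isSubZmodule of skew_group_ring by <:].

Definition skew_term x y g h : {malg A[G]} :=
  << al g (al g^-1%g x@_g ** y@_h) *g (g * h)%g >>.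

Definition malg_skew_mul x y : {malg A[G]} :=
  \sum_(g <- msupp x) \sum_(h <- msupp y) skew_term x y g h.

Fact malg_skew_mul_closed (u v : skew_group_ring) :
  malg_skew_mul (val u) (val v) \in skew_pred.
Proof.
apply: rpred_sum => g _; apply: rpred_sum => h _; apply/skew_predP => k.
rewrite mcoeffU; case: eqP => [<-|_]; last by rewrite mulr0n; apply: pa_dom0.
have /skew_predP Du := valP u; have /skew_predP Dv := valP v.
by apply: pa_map_dom; [apply/pa_domMr/pa_mapVP/Du | apply/pa_domMl/Dv].
Qed.

Definition skew_mul (u v : skew_group_ring) : skew_group_ring :=
  SkewGroupRing (malg_skew_mul_closed u v).

Lemma malg_skew_mulEw (X Y : {fset G}) x y :
    (msupp x `<=` X)%fset -> (msupp y `<=` Y)%fset ->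
  malg_skew_mul x y = \sum_(g <- X) \sum_(h <- Y) skew_term x y g h.
Proof.
move=> sX sY; rewrite /malg_skew_mul (big_fset_incl _ sX) => [|g _ gx].
  apply: eq_bigr => g _; rewrite (big_fset_incl _ sY) // => h _ hy.
  by rewrite /skew_term (mcoeff_outdom hy) nmulr0 pa_map0 raddf0.
rewrite big1 // => h _.
by rewrite /skew_term (mcoeff_outdom gx) pa_map0 nmul0r pa_map0 raddf0.
Qed.

Fact skew_mulDl : left_distributive skew_mul +%R.
Proof.
move=> u v w; apply: val_inj => /=.
set X := (msupp (val u) `|` msupp (val v))%fset.
have sX1 : (msupp (val u) `<=` X)%fset by apply: fsubsetUl.
have sX2 : (msupp (val v) `<=` X)%fset by apply: fsubsetUr.
have sX : (msupp (val u + val v) `<=` X)%fset by apply: msuppD_le.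
rewrite (malg_skew_mulEw sX1 (fsubset_refl _)).
rewrite (malg_skew_mulEw sX2 (fsubset_refl _)).
rewrite (malg_skew_mulEw sX (fsubset_refl _)) -big_split /=.
apply: eq_bigr => g _; rewrite -big_split /=; apply: eq_bigr => h _.
have /skew_predP Du := valP u; have /skew_predP Dv := valP v.
rewrite /skew_term mcoeffD pa_mapD ?invgK // nmulDl.
by rewrite pa_mapD ?raddfD //; apply/pa_domMr/pa_mapVP.
Qed.

Fact skew_mulDr : right_distributive skew_mul +%R.
Proof.
move=> w u v; apply: val_inj => /=.
set Y := (msupp (val u) `|` msupp (val v))%fset.
have sY1 : (msupp (val u) `<=` Y)%fset by apply: fsubsetUl.
have sY2 : (msupp (val v) `<=` Y)%fset by apply: fsubsetUr.
have sY : (msupp (val u + val v) `<=` Y)%fset by apply: msuppD_le.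
rewrite (malg_skew_mulEw (fsubset_refl _) sY1).
rewrite (malg_skew_mulEw (fsubset_refl _) sY2).
rewrite (malg_skew_mulEw (fsubset_refl _) sY) -big_split /=.
apply: eq_bigr => g _; rewrite -big_split /=; apply: eq_bigr => h _.
have /skew_predP Dw := valP w.
rewrite /skew_term mcoeffD nmulDr.
by rewrite pa_mapD ?raddfD //; apply/pa_domMr/pa_mapVP.
Qed.

HB.instance Definition _ := Zmodule_isNaRing.Build skew_group_ring
  skew_mulDl skew_mulDr.

End SkewGroupRing.

(* The last two axioms say that modules over unital rings are unitary. *)
Record bimodule (R S : naRingType) := Bimodule {
  bimod_sort :> zmodType;
  lact : R -> bimod_sort -> bimod_sort;
  ract : bimod_sort -> S -> bimod_sort;
  lactDl : forall r1 r2 m, lact (r1 + r2) m = lact r1 m + lact r2 m;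
  lactDr : forall r m1 m2, lact r (m1 + m2) = lact r m1 + lact r m2;
  lactA : forall r1 r2 m, lact (r1 ** r2) m = lact r1 (lact r2 m);
  ractDl : forall m1 m2 s, ract (m1 + m2) s = ract m1 s + ract m2 s;
  ractDr : forall m s1 s2, ract m (s1 + s2) = ract m s1 + ract m s2;
  ractA : forall m s1 s2, ract m (s1 ** s2) = ract (ract m s1) s2;
  lractA : forall r m s, ract (lact r m) s = lact r (ract m s);
  lact1 : forall e, is_identity e -> forall m, lact e m = m;
  ract1 : forall e, is_identity e -> forall m, ract m e = m
}.

(* M \otimes_S M' as the quotient of the free abelian group on M * M' by the
   subgroup generated by the usual relators. *)
Section TensorProduct.
Variables (R S T : naRingType) (M : bimodule R S) (M' : bimodule S T).

Local Notation free := {malg int[(M * M')%type]}.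

Definition tensor_relators : set free :=
  [set t |
    [\/ exists x y x', t = << (x + y, x') >> - << (x, x') >> - << (y, x') >>,
        exists x x' y', t = << (x, x' + y') >> - << (x, x') >> - << (x, y') >>
      | exists x s x', t = << (ract x s, x') >> - << (x, lact s x') >>]].

Definition subgroup (H : set free) : Prop :=
  H 0 /\ forall t u, H t -> H u -> H (t - u).

Definition tensor_null : {pred free} :=
  fun t => `[< smallest subgroup tensor_relators t >].

Fact tensor_null_zmod_closed : zmod_closed tensor_null.
Proof.
split=> [|t u /asboolP Nt /asboolP Nu]; apply/asboolP => H [sH rH].
  exact: sH.1.
by apply: sH.2; [apply: Nt | apply: Nu].
Qed.
HB.instance Definition _ :=
  GRing.isZmodClosed.Build free tensor_null tensor_null_zmod_closed.

Definition tensor : Type := {ideal_quot tensor_null}.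
HB.instance Definition _ := GRing.Zmodule.on tensor.

Definition tens (x : M) (x' : M') : tensor :=
  \pi_({ideal_quot tensor_null})%qT << (x, x') >>.

End TensorProduct.

Arguments tensor_relators {R S T} M M' _.
Arguments tensor_null {R S T} M M' _.

(* The actions of R and T on M \otimes_S M' are given by
   r . (x \otimes x') = (r x) \otimes x' and
   (x \otimes x') . t = x \otimes (x' t); since pure tensors generate the tensor
   product, an additive map is a bimodule map as soon as it commutes with the
   actions on pure tensors. *)
Record morita_context (R R' : naRingType) := MoritaContext {
  mc_M : bimodule R R';
  mc_M' : bimodule R' R;
  mc_tau : {additive tensor mc_M mc_M' -> R};
  mc_tau' : {additive tensor mc_M' mc_M -> R'};
  mc_tau_l : forall r x x',
    mc_tau (tens (lact r x) x') = r ** mc_tau (tens x x');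
  mc_tau_r : forall x x' r,
    mc_tau (tens x (ract x' r)) = mc_tau (tens x x') ** r;
  mc_tau'_l : forall r x' x,
    mc_tau' (tens (lact r x') x) = r ** mc_tau' (tens x' x);
  mc_tau'_r : forall x' x r,
    mc_tau' (tens x' (ract x r)) = mc_tau' (tens x' x) ** r;
  mc_assoc : forall x x' y,
    lact (mc_tau (tens x x')) y = ract x (mc_tau' (tens x' y));
  mc_assoc' : forall x' x y',
    lact (mc_tau' (tens x' x)) y' = ract x' (mc_tau (tens x y'))
}.

Definition morita_equivalent (R R' : naRingType) : Prop :=
  [/\ associative (@nmul R), associative (@nmul R')
    & exists C : morita_context R R',
        range (mc_tau C) = setT /\ range (mc_tau' C) = setT].

(* Main.v *)
Require Import Defs.
From mathcomp Require Import all_boot all_algebra.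
From HB Require Import structures.
From mathcomp Require Import generic_quotient ring_quotient finmap monalg.
From mathcomp Require Import boolp classical_sets.

(* The isomorphic copy of A in B is an ideal with identity e, and E = e delta_1
   is an idempotent of S = B \rtimes G. Applying phi to coefficients embeds
   A \rtimes G in S with image E S E, because (e b beta_g(e)) delta_g has its
   coefficient in phi(A) `&` beta_g(phi(A)) = phi(D_g). The ideal S E S contains
   beta_g(phi(a)) delta_k = delta_g E (phi(a) delta_(g^-1 k)), so the fact that
   the translates of phi(A) generate B forces S E S = S. Hence A \rtimes G is a
   full corner of S, and (E S, S E) is a surjective Morita context. *)

Set Implicit Arguments.
Unset Strict Implicit.
Unset Printing Implicit Defensive.

Import GRing.Theory.

Local Open Scope classical_set_scope.
Local Open Scope ring_scope.

(** * Additive maps out of free abelian groups and tensor products *)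

Section FreeLift.
Variables (T : choiceType) (V : zmodType) (f : T -> V).

Definition free_lift (t : {malg T}) : V := \sum_(k <- msupp t) f k *~ t@_k.

(** Zero coefficients contribute nothing, so elements with different supports can be summed over one
    common finite set; additivity rests on this. *)
Lemma free_liftEw (X : {fset T}) (t : {malg T}) : (msupp t `<=` X)%fset ->
  free_lift t = \sum_(k <- X) f k *~ t@_k.
Proof.
move=> sX; rewrite /free_lift (big_fset_incl _ sX) // => k _ kt.
by rewrite (mcoeff_outdom kt) mulr0z.
Qed.

Fact free_lift_is_zmod_morphism : zmod_morphism free_lift.
Proof.
move=> t u; set X := (msupp t `|` msupp u)%fset.
rewrite (@free_liftEw X) ?msuppB_le // (@free_liftEw X t) ?fsubsetUl //.
rewrite (@free_liftEw X u) ?fsubsetUr // -sumrB.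
by apply: eq_bigr => k _; rewrite mcoeffB mulrzBr.
Qed.
HB.instance Definition _ := GRing.isZmodMorphism.Build {malg T} V free_lift
  free_lift_is_zmod_morphism.

Lemma free_liftU k : free_lift << k >> = f k.
Proof.
by rewrite (@free_liftEw [fset k]%fset) ?msuppU_le // big_seq_fset1 mcoeffUU.
Qed.

End FreeLift.

Section TensorLift.
Variables (R S T : naRingType) (M : bimodule R S) (M' : bimodule S T).
Variables (V : zmodType) (b : M -> M' -> V).
Hypothesis bDl : forall x y x', b (x + y) x' = b x x' + b y x'.
Hypothesis bDr : forall x x' y', b x (x' + y') = b x x' + b x y'.
Hypothesis bA : forall x s x', b (ract x s) x' = b x (lact s x').

Let Flin (t : {malg int[(M * M')%type]}) : V :=
  free_lift (fun p => b p.1 p.2) t.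

Let FB t u : Flin (t - u) = Flin t - Flin u.
Proof. exact: raddfB. Qed.

(** The kernel of [Flin] is a subgroup that contains the relators, because [b] is biadditive and
    balanced; hence it contains the smallest such subgroup. *)
Let F_null t : t \in tensor_null M M' -> Flin t = 0.
Proof.
move=> /asboolP /(_ [set t | Flin t = 0]); apply; split.
  by split=> [|u v /= Fu Fv]; rewrite ?FB ?Fu ?Fv ?subr0 //; apply: raddf0.
move=> u [[x [y [x' ->]]]|[x [x' [y' ->]]]|[x [s [x' ->]]]] /=.
- by rewrite !FB /Flin !free_liftU /= bDl addrAC addrK subrr.
- by rewrite !FB /Flin !free_liftU /= bDr addrAC addrK subrr.
- by rewrite FB /Flin !free_liftU /= bA subrr.
Qed.

(** The chosen representative of the class of [t] differs from [t] by a null element, so the choice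
    does not affect [Flin]. *)
Let F_repr t :
  Flin (repr (\pi_({ideal_quot tensor_null M M'})%qT t)) = Flin t.
Proof.
apply/eqP; rewrite -subr_eq0 -FB; apply/eqP/F_null.
by rewrite Quotient.idealrBE reprK.
Qed.

Definition tensor_lift (t : tensor M M') : V :=
  Flin (repr (t : {ideal_quot tensor_null M M'})).

Fact tensor_lift_is_zmod_morphism : zmod_morphism tensor_lift.
Proof.
move=> t u; rewrite /tensor_lift -FB -[RHS]F_repr raddfB /=.
by congr (Flin (repr _)); rewrite !reprK.
Qed.

Lemma tensor_universal :
  exists F : {additive tensor M M' -> V}, forall x x', F (tens x x') = b x x'.
Proof.
pose mF := GRing.isZmodMorphism.Build (tensor M M') V tensor_lift
  tensor_lift_is_zmod_morphism.
pose F : {additive tensor M M' -> V} := HB.pack tensor_lift mF.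
by exists F => x x'; rewrite /= /tensor_lift F_repr /Flin free_liftU.
Qed.

End TensorLift.

(** * Morita contexts from balanced pairings *)

Section MoritaPairing.
Variables (R S : naRingType) (M : bimodule R S) (M' : bimodule S R).
Variables (b : M -> M' -> R) (b' : M' -> M -> S).
Hypothesis RA : associative (@nmul R).
Hypothesis SA : associative (@nmul S).
Hypothesis bDl : forall x y x', b (x + y) x' = b x x' + b y x'.
Hypothesis bDr : forall x x' y', b x (x' + y') = b x x' + b x y'.
Hypothesis bA : forall x s x', b (ract x s) x' = b x (lact s x').
Hypothesis b'Dl : forall x' y' x, b' (x' + y') x = b' x' x + b' y' x.
Hypothesis b'Dr : forall x' x y, b' x' (x + y) = b' x' x + b' x' y.
Hypothesis b'A : forall x' r x, b' (ract x' r) x = b' x' (lact r x).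
Hypothesis b_l : forall r x x', b (lact r x) x' = r ** b x x'.
Hypothesis b_r : forall x x' r, b x (ract x' r) = b x x' ** r.
Hypothesis b'_l : forall s x' x, b' (lact s x') x = s ** b' x' x.
Hypothesis b'_r : forall x' x s, b' x' (ract x s) = b' x' x ** s.
Hypothesis b_b' : forall x x' y, lact (b x x') y = ract x (b' x' y).
Hypothesis b'_b : forall x' x y', lact (b' x' x) y' = ract x' (b x y').
Hypothesis b_full : forall H : set R, H 0 ->
  (forall r r', H r -> H r' -> H (r + r')) -> (forall x x', H (b x x')) ->
  forall r, H r.
Hypothesis b'_full : forall H : set S, H 0 ->
  (forall s s', H s -> H s' -> H (s + s')) -> (forall x' x, H (b' x' x)) ->
  forall s, H s.

(** The context axioms concern pure tensors only, where [tau] and [tau'] agree with [b] and [b'].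
    Each range contains 0 and the values of the pairing and is closed under addition, so the
    fullness hypotheses, phrased as induction principles, give surjectivity. *)
Lemma morita_pairing : morita_equivalent R S.
Proof.
have [tau tauE] := tensor_universal bDl bDr bA.
have [tau' tau'E] := tensor_universal b'Dl b'Dr b'A.
split=> //.
unshelve eexists (@MoritaContext R S M M' tau tau' _ _ _ _ _ _); last first.
  split; apply/seteqP; split=> // z _; move: z => /=.
    apply: b_full => [|_ _ [t _ <-] [u _ <-]|x x'].
    - by exists 0 => //; rewrite raddf0.
    - by exists (t + u); rewrite ?raddfD.
    - by exists (tens x x').
  apply: b'_full => [|_ _ [t _ <-] [u _ <-]|x' x].
  - by exists 0 => //; rewrite raddf0.
  - by exists (t + u); rewrite ?raddfD.
  - by exists (tens x' x).
all: by intros; rewrite ?tauE ?tau'E.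
Qed.

End MoritaPairing.

(** * Full corners of an associative ring *)

Section FixedPoints.
Variables (V : zmodType) (p : {additive V -> V}).

Definition fixed_pred : {pred V} := fun x => p x == x.

Fact fixed_zmod_closed : zmod_closed fixed_pred.
Proof.
split=> [|x y /eqP px /eqP py]; first by apply/eqP; apply: raddf0.
by apply/eqP; rewrite raddfB px py.
Qed.
HB.instance Definition _ :=
  GRing.isZmodClosed.Build V fixed_pred fixed_zmod_closed.

Record fixed := Fixed { fixed_val :> V; _ : fixed_val \in fixed_pred }.

HB.instance Definition _ := [isSub for fixed_val].
HB.instance Definition _ := [Choice of fixed by <:].
HB.instance Definition _ := [SubChoice_isSubZmodule of fixed by <:].

Lemma fixedE (x : fixed) : p (val x) = val x.
Proof. exact/eqP/(valP x). Qed.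

Definition to_fixed x (px : p x = x) : fixed := Fixed (introT eqP px).

End FixedPoints.

Section NaRingAdditive.
Variables (R : naRingType) (x : R).

Definition rnmul := fun y => y ** x.

Fact nmul_is_zmod_morphism : zmod_morphism (nmul x).
Proof. by move=> y z; apply: (addIr (x ** z)); rewrite -nmulDr !subrK. Qed.
HB.instance Definition _ := GRing.isZmodMorphism.Build R R (nmul x)
  nmul_is_zmod_morphism.

Fact rnmul_is_zmod_morphism : zmod_morphism rnmul.
Proof. by move=> y z; apply: (addIr (z ** x)); rewrite -nmulDl !subrK. Qed.
HB.instance Definition _ := GRing.isZmodMorphism.Build R R rnmul
  rnmul_is_zmod_morphism.

End NaRingAdditive.

Section FullCorner.
Variables (R S : naRingType) (f : {additive R -> S}) (E : S).
Hypothesis f_inj : injective f.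
Hypothesis fM : {morph f : x y / x ** y}.
Hypothesis SA : associative (@nmul S).
Hypothesis EE : E ** E = E.
Hypothesis Ef : forall r, E ** f r = f r.
Hypothesis fE : forall r, f r ** E = f r.
Hypothesis f_corner : forall s, exists r, f r = E ** s ** E.
(* S E S = S, where S E S is the additive span of the products x E y. *)
Hypothesis E_full : forall H : set S, H 0 ->
  (forall x y, H x -> H y -> H (x + y)) -> (forall x y, H (x ** E ** y)) ->
  forall z, H z.

(** Some [r] has f(r) = E, whence f(e) = f(e) E = f(e r) = f(r) = E. The unitarity axioms of the
    bimodules need this. *)
Let f_identity e : is_identity e -> f e = E.
Proof.
move=> e1; have [r fr] := f_corner E; rewrite !EE in fr.
by rewrite -(fE e) -fr -fM (e1 r).1.
Qed.

(** Associativity descends along the injective multiplicative map [f]; for the skew group ring of a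
    partial action it is not automatic. *)
Let RA : associative (@nmul R).
Proof. by move=> x y z; apply: f_inj; rewrite !fM SA. Qed.

(** As [E] is idempotent, E S and S E are the fixed points of left and right multiplication by
    [E]. *)
Let M := fixed (nmul E).
Let M' := fixed (rnmul E).

Let ME (m : M) : E ** val m = val m.
Proof. exact: (fixedE m). Qed.
Let M'E (m : M') : val m ** E = val m.
Proof. exact: (fixedE m). Qed.

(** [R] acts through [f]. The actions are transparent, so the bimodule axioms reduce to identities
    between products in [S]. *)
Let lM (r : R) (m : M) : M.
Proof. by apply: (@to_fixed _ _ (f r ** val m)); rewrite /= SA Ef. Defined.
Let rM (m : M) (s : S) : M.
Proof. by apply: (@to_fixed _ _ (val m ** s)); rewrite /= SA ME. Defined.
Let lM' (s : S) (m : M') : M'.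
Proof.
by apply: (@to_fixed _ _ (s ** val m)); rewrite /= /rnmul -SA M'E.
Defined.
Let rM' (m : M') (r : R) : M'.
Proof.
by apply: (@to_fixed _ _ (val m ** f r)); rewrite /= /rnmul -SA fE.
Defined.

Definition corner_bimodule : bimodule R S.
Proof.
refine (@Bimodule R S M lM rM _ _ _ _ _ _ _ _ _);
  intros; apply: val_inj; rewrite /= ?fM -?SA ?raddfD ?nmulDl ?nmulDr //.
- by rewrite (f_identity H) ME.
- by have [] := H (val m).
Defined.

Definition corner_bimodule' : bimodule S R.
Proof.
refine (@Bimodule S R M' lM' rM' _ _ _ _ _ _ _ _ _);
  intros; apply: val_inj; rewrite /= ?fM ?SA ?raddfD ?nmulDl ?nmulDr //.
- by have [] := H (val m).
- by rewrite (f_identity H) M'E.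
Defined.

Lemma full_corner_morita : morita_equivalent R S.
Proof.
(* A product of elements of E S and S E lies in E S E, the image of [f]. Injectivity of [f]
   transfers the laws of the product to the chosen preimages. *)
have /choice [c fc] : forall p : M * M', exists r, f r = val p.1 ** val p.2.
  case=> m m'; have [r fr] := f_corner (val m ** val m').
  by exists r; rewrite fr /= SA ME -SA M'E.
have fc' m m' : f (c (m, m')) = val m ** val m' by apply: fc.
apply: (@morita_pairing R S corner_bimodule corner_bimodule'
  (fun m m' => c (m, m')) (fun m' m => val m' ** val m)) => //=.
- by move=> x y x'; apply: f_inj; rewrite raddfD /= !fc' nmulDl.
- by move=> x x' y'; apply: f_inj; rewrite raddfD /= !fc' nmulDr.
- by move=> x s x'; apply: f_inj; rewrite !fc' /= SA.
- by move=> x' y' x; rewrite nmulDl.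
- by move=> x' x y; rewrite nmulDr.
- by move=> r x x'; apply: f_inj; rewrite fM !fc' /= SA.
- by move=> x x' r; apply: f_inj; rewrite fM !fc' /= SA.
- by move=> x x' y; apply: val_inj; rewrite /= fc' SA.
- by move=> x' x y'; apply: val_inj; rewrite /= fc' SA.
(* Every [r] is itself a value of the pairing, at (E, f(r)), since E f(r) = f(r). *)
- move=> H _ _ Hc r; have rE : rnmul E (f r) = f r by apply: fE.
  suff <- : c (to_fixed EE, to_fixed rE) = r by apply: Hc.
  by apply: f_inj; rewrite fc' /= Ef.
(* Idempotence splits x E y as (x E)(E y), with factors in S E and E S. *)
- move=> H H0 HD Hb; apply: E_full => // x y.
  have xE : rnmul E (x ** E) = x ** E by rewrite /rnmul -SA EE.
  have Ey : E ** (E ** y) = E ** y by rewrite SA EE.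
  by have := Hb (to_fixed xE) (to_fixed Ey); rewrite /= SA -(SA x) EE.
Qed.

End FullCorner.

(** * Monomials of a skew group ring *)

Section SkewTerms.
Variables (K : fieldType) (G : groupType) (A : nuAlgType K).
Variable alpha : partial_action G A.
Local Notation D := (pa_dom alpha).
Local Notation al := (pa_map alpha).
Local Notation skew := (skew_group_ring alpha).

(* This is a delta_g when a \in D_g, and the junk value 0 otherwise. *)
Definition delta g (a : A) : skew := insubd 0 << a *g g >>.

Lemma skew_coefP (u : skew) g : D g (val u)@_g.
Proof. by have /skew_predP := valP u; apply. Qed.

Lemma val_delta g a : D g a -> val (delta g a) = << a *g g >>.
Proof.
move=> Da; rewrite /delta val_insubd ifT //; apply/skew_predP => k.
by rewrite mcoeffU; case: eqP => [<-|_] //; rewrite mulr0n; apply: pa_dom0.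
Qed.

Lemma delta0 g : delta g 0 = 0.
Proof. by apply: val_inj; rewrite val_delta ?monalgU0 //; apply: pa_dom0. Qed.

Lemma deltaD g a b : D g a -> D g b -> delta g (a + b) = delta g a + delta g b.
Proof.
move=> Da Db; apply: val_inj.
by rewrite /= !val_delta ?monalgUD //; apply: pa_domD.
Qed.

Lemma delta_mul g h a b : D g a -> D h b ->
  delta g a ** delta h b = delta (g * h)%g (al g (al g^-1%g a ** b)).
Proof.
move=> Da Db; apply: val_inj; rewrite [RHS]val_delta; last first.
  by apply: pa_map_dom; [apply/pa_domMr/pa_mapVP | apply: pa_domMl].
rewrite /= !val_delta // (malg_skew_mulEw _ msuppU_le msuppU_le).
by rewrite !big_seq_fset1 /skew_term !mcoeffUU.
Qed.

Lemma skew_ind (P : skew -> Prop) : P 0 ->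
  (forall u v, P u -> P v -> P (u + v)) ->
  (forall g a, D g a -> P (delta g a)) -> forall u, P u.
Proof.
move=> P0 PD Pdelta u.
have -> : u = \sum_(g <- msupp (val u)) delta g (val u)@_g.
  apply: val_inj; rewrite raddf_sum [LHS]monalgE; apply: eq_bigr => g _.
  exact/esym/val_delta/skew_coefP.
by apply: big_ind => // g _; apply/Pdelta/skew_coefP.
Qed.

End SkewTerms.

(** * Coefficientwise maps between skew group rings *)

Section SkewMap.
Variables (K : fieldType) (G : groupType) (A B : nuAlgType K).
Variables (alpha : partial_action G A) (beta : partial_action G B).
Variable phi : {additive A -> B}.
Hypothesis phi_dom : forall g a, pa_dom alpha g a -> pa_dom beta g (phi a).

Let malg_map (u : skew_group_ring alpha) : {malg B[G]} :=
  [malg g in msupp (val u) => phi (val u)@_g].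

Let mcoeff_malg_map u g : (malg_map u)@_g = phi (val u)@_g.
Proof.
by rewrite mcoeffE; case: ifPn => // /mcoeff_outdom ->; rewrite raddf0.
Qed.

Fact malg_map_skew u : malg_map u \in skew_pred beta.
Proof.
by apply/skew_predP => g; rewrite mcoeff_malg_map; apply/phi_dom/skew_coefP.
Qed.

Definition skew_map u : skew_group_ring beta := SkewGroupRing (malg_map_skew u).

Lemma skew_mapE u g : (val (skew_map u))@_g = phi (val u)@_g.
Proof. exact: mcoeff_malg_map. Qed.

Fact skew_map_is_zmod_morphism : zmod_morphism skew_map.
Proof.
move=> u v; apply/val_inj/malgP => g.
by rewrite /= mcoeffB !skew_mapE -raddfB -mcoeffB.
Qed.
HB.instance Definition _ := GRing.isZmodMorphism.Build _ _ skew_map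
  skew_map_is_zmod_morphism.

Lemma skew_map_inj : injective phi -> injective skew_map.
Proof.
move=> phi_inj u v uv; apply/val_inj/malgP => g; apply: phi_inj.
by rewrite -!skew_mapE uv.
Qed.

Lemma skew_map_delta g a :
  pa_dom alpha g a -> skew_map (delta alpha g a) = delta beta g (phi a).
Proof.
move=> Da; apply/val_inj/malgP => h.
rewrite skew_mapE !val_delta ?mcoeffU //; last exact: phi_dom.
by rewrite raddfMn.
Qed.

(** Biadditivity reduces this to monomials, where the intertwining relation is used at g for the
    outer map and at g^-1 for the inner one. *)
Lemma skew_mapM : (forall x y, phi (x ** y) = phi x ** phi y) ->
  (forall g x, pa_dom alpha g^-1%g x ->
     phi (pa_map alpha g x) = pa_map beta g (phi x)) ->
  {morph skew_map : u v / u ** v}.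
Proof.
move=> phiM phi_al u v.
elim/skew_ind: u v => [|u u' IHu IHu'|g a Da] v.
- by rewrite nmul0r raddf0 nmul0r.
- by rewrite nmulDl !raddfD /= nmulDl IHu IHu'.
elim/skew_ind: v => [|v v' IHv IHv'|h b Db].
- by rewrite nmulr0 raddf0 nmulr0.
- by rewrite nmulDr !raddfD /= IHv IHv'.
have Da' := pa_mapVP Da; rewrite delta_mul // !skew_map_delta //; last first.
  by apply: pa_map_dom; [apply: pa_domMr | apply: pa_domMl].
rewrite delta_mul; [|exact: phi_dom|exact: phi_dom].
rewrite phi_al; last exact: pa_domMr.
by rewrite phiM phi_al ?invgK.
Qed.

End SkewMap.

(** * Skew group rings of global actions *)

Section GlobalAction.
Variables (K : fieldType) (G : groupType) (B : nuAlgType K).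
Variable beta : partial_action G B.
Hypothesis beta_global : global beta.
Local Notation be := (pa_map beta).
Local Notation delta := (delta beta).

Lemma global_dom g x : pa_dom beta g x.
Proof. by rewrite beta_global. Qed.
Let domT := global_dom.

Lemma global_mapK g : cancel (be g) (be g^-1%g).
Proof. by move=> x; rewrite pa_mapK. Qed.

Lemma global_mapVK g : cancel (be g^-1%g) (be g).
Proof. by move=> x; have := global_mapK g^-1%g x; rewrite invgK. Qed.

Lemma global_mapM g x y : be g (x ** y) = be g x ** be g y.
Proof. exact: pa_mapM. Qed.

Lemma global_map_comp g h x : be g (be h x) = be (g * h)%g x.
Proof. by apply: pa_comp; split=> //; split. Qed.

Lemma global_delta_mul g h a b :
  delta g a ** delta h b = delta (g * h)%g (a ** be g b).
Proof. by rewrite delta_mul // global_mapM global_mapVK. Qed.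

(** On monomials both bracketings give a beta_g(b) beta_gh(c) delta_ghk. *)
Lemma global_skew_mulA : associative (@nmul (skew_group_ring beta)).
Proof.
move=> u v w; elim/skew_ind: u v w => [|u u' IHu IHu'|g a _] v w.
- by rewrite !nmul0r.
- by rewrite !nmulDl IHu IHu'.
elim/skew_ind: v w => [|v v' IHv IHv'|h b _] w.
- by rewrite nmul0r nmulr0 nmul0r.
- by rewrite !(nmulDl, nmulDr) IHv IHv'.
elim/skew_ind: w => [|w w' IHw IHw'|k c _].
- by rewrite !nmulr0.
- by rewrite !nmulDr IHw IHw'.
by rewrite !global_delta_mul global_mapM global_map_comp nmulA mulgA.
Qed.

End GlobalAction.

(** * The full corner given by an enveloping action *)

Theorem theorem5p4 (K : fieldType) (G : groupType) (A B : nuAlgType K)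
    (alpha : partial_action G A) (beta : partial_action G B)
    (A_unital : unital A) (B_unital : unital B)
    (alpha_beta : enveloping alpha beta) :
  morita_equivalent (skew_group_ring alpha) (skew_group_ring beta).
Proof.
have [beta_global [phi [[phi_inj phiM [_ phi_ideal]]
  [phi_dom phi_al phi_gen]]]] := alpha_beta.
have [one_A oneAP] := A_unital; have [one_B oneBP] := B_unital.
have domT g x : pa_dom beta g x by apply: global_dom.
pose e := phi one_A.
have eM x : range phi x -> e ** x = x.
  by case=> a _ <-; rewrite -phiM (oneAP a).1.
have Me x : range phi x -> x ** e = x.
  by case=> a _ <-; rewrite -phiM (oneAP a).2.
have range_e : range phi e by exists one_A.
have phi_domT g a : pa_dom alpha g a -> pa_dom beta g (phi a) by [].
pose f : {additive _ -> _} := skew_map phi_domT.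
have be1 x : pa_map beta 1%g x = x by apply: pa_map1.
pose E := delta beta 1%g e.
have dM := global_delta_mul beta_global.
have f_delta g a :
  pa_dom alpha g a -> f (delta alpha g a) = delta beta g (phi a).
  exact: skew_map_delta.
apply: (@full_corner_morita _ _ f E) => //.
- exact: skew_map_inj.
- exact: skew_mapM.
- exact: global_skew_mulA.
- by rewrite dM be1 mulg1 eM.
- elim/skew_ind => [|u v IHu IHv|g a Da].
  + by rewrite raddf0 nmulr0.
  + by rewrite raddfD nmulDr IHu IHv.
  by rewrite f_delta // dM be1 mul1g eM //; exists a.
- elim/skew_ind => [|u v IHu IHv|g a Da].
  + by rewrite raddf0 nmul0r.
  + by rewrite raddfD nmulDl IHu IHv.
  rewrite f_delta // dM mulg1.
  (* Right multiplication by [E] multiplies the coefficient by beta_g(e), which is an identity on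
     beta_g(phi(A)), where phi(a) lies. *)
  have [_ [_ [b _ <-] <-]] : (range phi `&` pa_map beta g @` range phi) (phi a).
    by rewrite -phi_dom; exists a.
  by rewrite -global_mapM // Me //; exists b.
- elim/skew_ind => [|u v [r fr] [s fs]|g b _].
  + by exists 0; rewrite raddf0 nmulr0 nmul0r.
  + by exists (r + s); rewrite raddfD nmulDr nmulDl fr fs.
  have : (phi @` pa_dom alpha g) (e ** b ** pa_map beta g e).
    rewrite phi_dom; split.
      by apply: (phi_ideal _ _ _).2; apply: (phi_ideal _ _ range_e).2.
    (* Pulling e b beta_g(e) back by beta_g leaves a right factor [e], which puts the result in the
       ideal phi(A). *)
    exists (pa_map beta g^-1%g (e ** b) ** e).
      exact: (phi_ideal _ _ range_e).1.
    by rewrite global_mapM // global_mapVK.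
  case=> a Da phi_a; exists (delta alpha g a).
  by rewrite f_delta // phi_a !dM be1 mul1g mulg1.
move=> H H0 HD HE.
(* H is only an additive subgroup: multiplying by an arbitrary x makes C stable
   under scaling and products. *)
pose C : set B := [set b | forall x k, H (delta beta k (b ** x))].
have C_sub : subalgebra C.
  split; first split.
  - by move=> x k; rewrite nmul0r delta0.
  - by move=> b c Cb Cc x k; rewrite nmulDl deltaD //; apply: HD.
  - by move=> a b Cb x k; rewrite -nscaleAl nscaleAr.
  by move=> b c Cb _ x k; rewrite -nmulA.
have C_gen : (\bigcup_g pa_map beta g @` range phi) `<=` C.
  move=> _ [g _ [b range_b <-] x k /=].
  (* Writing x as beta_g(beta_(g^-1)(x)) moves the product inside beta_g, where the ideal phi(A)
     absorbs the second factor. *)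
  rewrite -(global_mapVK beta_global g x) -global_mapM //.
  set y := b ** _.
  have range_y : range phi y by apply: (phi_ideal _ _ range_b).2.
  (* The unit of [B] makes delta_g an element of the ring; the product equals beta_g(e y) delta_k,
     and e y = y. *)
  have := HE (delta beta g one_B) (delta beta (g^-1 * k)%g y).
  rewrite !dM mulg1 mulgA mulgV mul1g.
  by rewrite (oneBP _).1 -global_mapM // eM.
elim/skew_ind => // g b _.
have Cb : C b.
  by have : [set: B] b by []; rewrite -phi_gen; apply; split.
(* Taking the unit as the multiplier x recovers b delta_g itself. *)
by have := Cb one_B g; rewrite (oneBP b).2.
Qed.
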